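(* Let $\boxtimes$ be a monoidal product with embeddings on the category $\mathfrak{PreHilb}$. There is a one-to-one correspondence between universal lifts for $\boxtimes$ and universal products of $\ast$-representations for $\boxtimes$, given by the following two mutually inverse assignments. (a) To a universal product of $\ast$-representations $\odot$ one assigns the universal lift $(\lambda^{\odot},\rho^{\odot})$ with $$\lambda^{\odot}_{H_1,H_2} := \bigl(\mathrm{id}_{L_{\mathrm a}(H_1)}\odot \mathrm{id}_{L_{\mathrm a}(H_2)}\bigr)\big|_{L_{\mathrm a}(H_1)},\qquad \rho^{\odot}_{H_1,H_2} := \bigl(\mathrm{id}_{L_{\mathrm a}(H_1)}\odot \mathrm{id}_{L_{\mathrm a}(H_2)}\bigr)\big|_{L_{\mathrm a}(H_2)}$$ for all pre-Hilbert spaces $H_1,H_2$. (b) To a universal lift $(\lambda,\rho)$ one assigns the universal product of $\ast$-representations ${}_\lambda\odot_\rho$ with $$\pi_1\mathbin{{}_\lambda\odot_\rho}\pi_2 := (\lambda_{H_1,H_2}\circ\pi_1)\sqcup(\rho_{H_1,H_2}\circ\pi_2)$$ for all $\ast$-representations $\pi_k\colon A_k\to L_{\mathrm a}(H_k)$, $k=1,2$.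
   Context: Pre-Hilbert spaces. All pre-Hilbert spaces are complex and equipped with a distinguished unit vector, always denoted $\Omega$. $L_{\mathrm a}(H)$ is the $\ast$-algebra of adjointable linear operators $T\colon H\to H$ (those having an everywhere defined $T^*$ with $\langle Tx,y\rangle=\langle x,T^*y\rangle$). $\mathfrak{PreHilb}$ is the category of such pre-Hilbert spaces; its arrows are the (possibly non-adjointable) linear isometries $W\colon H\to G$ with $W\Omega=\Omega$. Monoidal product with embeddings. This is a bifunctor $\boxtimes\colon\mathfrak{PreHilb}\times\mathfrak{PreHilb}\to\mathfrak{PreHilb}$ with natural associativity and unitality isomorphisms making $(\mathfrak{PreHilb},\boxtimes)$ a monoidal category whose unit object is an initial object (so it is $\mathbb C\Omega$). It yields canonical arrows $H_1\cong H_1\boxtimes\mathbb C\Omega\to H_1\boxtimes H_2$ and $H_2\cong\mathbb C\Omega\boxtimes H_2\to H_1\boxtimes H_2$, through which $H_1,H_2$ are regarded as subspaces of $H_1\boxtimes H_2$. One identifies $H\boxtimes\mathbb C\Omega=H=\mathbb C\Omega\boxtimes H$ and $H_1\boxtimes(H_2\boxtimes H_3)=(H_1\boxtimes H_2)\boxtimes H_3$. Universal lifts. A left universal lift for $\boxtimes$ is a family of $\ast$-homomorphisms $\lambda_{H_1,H_2}\colon L_{\mathrm a}(H_1)\to L_{\mathrm a}(H_1\boxtimes H_2)$ (for all pre-Hilbert spaces $H_1,H_2$) such that: (left associativity) $\lambda_{H_1,H_2\boxtimes H_3}=\lambda_{H_1\boxtimes H_2,H_3}\circ\lambda_{H_1,H_2}$;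 (left universality of pre-Hilbert spaces) for all $T\in L_{\mathrm a}(H_1)$, $S\in L_{\mathrm a}(G_1)$ and arrows $W_k\colon H_k\to G_k$ ($k=1,2$) with $W_1T=SW_1$ and $W_1T^*=S^*W_1$, one has $(W_1\boxtimes W_2)\lambda_{H_1,H_2}(T)=\lambda_{G_1,G_2}(S)(W_1\boxtimes W_2)$; (left restriction) $\lambda_{H_1,H_2}(T)|_{H_1}=T$ for all $T\in L_{\mathrm a}(H_1)$. A right universal lift is a family of $\ast$-homomorphisms $\rho_{H_1,H_2}\colon L_{\mathrm a}(H_2)\to L_{\mathrm a}(H_1\boxtimes H_2)$ satisfying the mirror-image axioms (i.e. the family with reversed indices is a left universal lift for the opposite monoidal product); in particular $\rho_{H_1\boxtimes H_2,H_3}=\rho_{H_1,H_2\boxtimes H_3}\circ\rho_{H_2,H_3}$. A universal lift is a pair $(\lambda,\rho)$ of a left and a right universal lift satisfying (middle associativity) $\rho_{H_1,H_2\boxtimes H_3}\circ\lambda_{H_2,H_3}=\lambda_{H_1\boxtimes H_2,H_3}\circ\rho_{H_1,H_2}$ for all $H_1,H_2,H_3$. $\ast$-algebras. $\ast$-algebras are over $\mathbb C$ and not assumed unital. $A_1\sqcup A_2$ is the non-unital free product (the coproduct in the category of $\ast$-algebras and $\ast$-homomorphisms); $A_1,A_2$ are regarded as $\ast$-subalgebras of it. For $\ast$-homomorphisms $j_k\colon A_k\to B$, $j_1\sqcup j_2\colon A_1\sqcup A_2\to B$ is the unique $\ast$-homomorphism extending both; for $j_k\colon B_k\to A_k$,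 $j_1\sqcup j_2\colon B_1\sqcup B_2\to A_1\sqcup A_2$ is the induced $\ast$-homomorphism. $(A_1\sqcup A_2)\sqcup A_3$ and $A_1\sqcup(A_2\sqcup A_3)$ are identified. A $\ast$-representation of $A$ is a $\ast$-homomorphism $\pi\colon A\to L_{\mathrm a}(H)$. Universal products of $\ast$-representations. A universal product of $\ast$-representations for $\boxtimes$ is a rule assigning to any $\ast$-representations $\pi_k\colon A_k\to L_{\mathrm a}(H_k)$ ($k=1,2$) a $\ast$-representation $\pi_1\odot\pi_2\colon A_1\sqcup A_2\to L_{\mathrm a}(H_1\boxtimes H_2)$ such that: (associativity) $\pi_1\odot(\pi_2\odot\pi_3)=(\pi_1\odot\pi_2)\odot\pi_3$; (universality of $\ast$-algebras) $(\pi_1\odot\pi_2)\circ(j_1\sqcup j_2)=(\pi_1\circ j_1)\odot(\pi_2\circ j_2)$ for all $\ast$-homomorphisms $j_k\colon B_k\to A_k$; (universality of pre-Hilbert spaces) if $W_k\colon H_k\to G_k$ are arrows and $\pi_k\colon A_k\to L_{\mathrm a}(H_k)$, $\sigma_k\colon A_k\to L_{\mathrm a}(G_k)$ are $\ast$-representations with $W_k\pi_k(a)=\sigma_k(a)W_k$ for all $a\in A_k$, $k=1,2$, then $(W_1\boxtimes W_2)(\pi_1\odot\pi_2)(a)=(\sigma_1\odot\sigma_2)(a)(W_1\boxtimes W_2)$ for all $a\in A_1\sqcup A_2$; (restriction) $(\pi_1\odot\pi_2)(a)|_{H_k}=\pi_k(a)$ for $a\in A_k$, $k=1,2$. *)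

(* Defs.v *)
From HB Require Import structures.
From mathcomp Require Import all_boot all_order all_algebra.
From mathcomp Require Import sesquilinear complex.
From mathcomp Require Import boolp reals.

Set Implicit Arguments.
Unset Strict Implicit.
Unset Printing Implicit Defensive.

Import Order.TTheory GRing.Theory Num.Theory Num.Def.

Local Open Scope ring_scope.
Local Open Scope quotient_scope.

(* Everything below is developed over C : numClosedFieldType, for the sake of *)
(* the conjugation ^*; the complex numbers are the instance C := R[i] with    *)
(* R : realType.                                                              *)

HB.mixin Record Lmodule_isStarAlg (C : numClosedFieldType) A
    of GRing.Lmodule C A := {
  smul : A -> A -> A;
  star : A -> A;
  smulA : associative smul;
  smulDl : left_distributive smul +%R;
  smulDr : right_distributive smul +%R;
  smulZl : forall (c : C) x y, smul (c *: x) y = c *: smul x y;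
  smulZr : forall (c : C) x y, smul x (c *: y) = c *: smul x y;
  starD : {morph star : x y / x + y};
  starZ : forall (c : C) x, star (c *: x) = c^* *: star x;
  starM : forall x y, star (smul x y) = smul (star y) (star x);
  starK : involutive star
}.

#[short(type="starAlgType")]
HB.structure Definition StarAlg (C : numClosedFieldType) :=
  { A of GRing.Lmodule C A & Lmodule_isStarAlg C A }.

Record starHom (C : numClosedFieldType) (A B : starAlgType C) := StarHom {
  hom_fun :> A -> B;
  hom_linear : linear hom_fun;
  homM : {morph hom_fun : x y / smul x y};
  hom_star : {morph hom_fun : x / star x}
}.

Section StarHom.
Variable C : numClosedFieldType.

Lemma starHom_ext (A B : starAlgType C) (f g : starHom A B) : f =1 g -> f = g.
Proof.
case: f g => [f f1 f2 f3] [g g1 g2 g3] /= /funext fg; rewrite -fg in g1 g2 g3 *.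
by congr StarHom; apply: Prop_irrelevance.
Qed.

Definition hom_id (A : starAlgType C) : starHom A A.
Proof. by exists id. Defined.

Definition hom_comp (A B D : starAlgType C) (g : starHom B D) (f : starHom A B) :
  starHom A D.
Proof.
exists (g \o f).
- by move=> c x y /=; rewrite !hom_linear.
- by move=> x y /=; rewrite !homM.
- by move=> x /=; rewrite !hom_star.
Defined.

Lemma homD (A B : starAlgType C) (f : starHom A B) : {morph f : x y / x + y}.
Proof. by move=> x y; rewrite -[x]scale1r hom_linear !scale1r. Qed.

Lemma hom0 (A B : starAlgType C) (f : starHom A B) : f 0 = 0.
Proof. by apply: (addrI (f 0)); rewrite -homD !addr0. Qed.

Lemma homZ (A B : starAlgType C) (f : starHom A B) (c : C) x :
  f (c *: x) = c *: f x.
Proof. by rewrite -[c *: x]addr0 hom_linear hom0 addr0. Qed.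

End StarHom.

(* Terms built from elements of A and of B, modulo the congruence generated   *)
(* by the *-algebra axioms and by the requirement that the two inclusions be  *)
(* *-homomorphisms. [fp_inl], [fp_inr] and [fp_copair] make the quotient the  *)
(* coproduct of A and B: see [fp_copair_inl], [fp_copair_inr] and             *)
(* [fp_hom_ext].                                                              *)

Section FreeProduct.
Variables (C : numClosedFieldType) (A B : starAlgType C).

Inductive fp_term : Type :=
| FPl of A
| FPr of B
| FPadd of fp_term & fp_term
| FPscale of C & fp_term
| FPmul of fp_term & fp_term
| FPstar of fp_term.

Local Notation "x [+] y" := (FPadd x y) (at level 50, left associativity).
Local Notation "x [*] y" := (FPmul x y) (at level 40, left associativity).
Local Notation "c [*:] x" := (FPscale c x) (at level 40, left associativity).

Inductive fp_rel : fp_term -> fp_term -> Prop :=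
| fp_refl x : fp_rel x x
| fp_sym x y : fp_rel x y -> fp_rel y x
| fp_trans x y z : fp_rel x y -> fp_rel y z -> fp_rel x z
| fp_congD x x' y y' : fp_rel x x' -> fp_rel y y' -> fp_rel (x [+] y) (x' [+] y')
| fp_congZ c x x' : fp_rel x x' -> fp_rel (c [*:] x) (c [*:] x')
| fp_congM x x' y y' : fp_rel x x' -> fp_rel y y' -> fp_rel (x [*] y) (x' [*] y')
| fp_cong_star x x' : fp_rel x x' -> fp_rel (FPstar x) (FPstar x')
| fp_addA x y z : fp_rel (x [+] (y [+] z)) ((x [+] y) [+] z)
| fp_addC x y : fp_rel (x [+] y) (y [+] x)
| fp_add0 x : fp_rel (FPl 0 [+] x) x
| fp_addN x : fp_rel ((-1) [*:] x [+] x) (FPl 0)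
| fp_scaleA c d x : fp_rel (c [*:] (d [*:] x)) ((c * d) [*:] x)
| fp_scale1 x : fp_rel (1 [*:] x) x
| fp_scaleDr c x y : fp_rel (c [*:] (x [+] y)) (c [*:] x [+] c [*:] y)
| fp_scaleDl x c d : fp_rel ((c + d) [*:] x) (c [*:] x [+] d [*:] x)
| fp_mulA x y z : fp_rel (x [*] (y [*] z)) ((x [*] y) [*] z)
| fp_mulDl x y z : fp_rel ((x [+] y) [*] z) (x [*] z [+] y [*] z)
| fp_mulDr x y z : fp_rel (x [*] (y [+] z)) (x [*] y [+] x [*] z)
| fp_mulZl c x y : fp_rel ((c [*:] x) [*] y) (c [*:] (x [*] y))
| fp_mulZr c x y : fp_rel (x [*] (c [*:] y)) (c [*:] (x [*] y))
| fp_starD x y : fp_rel (FPstar (x [+] y)) (FPstar x [+] FPstar y)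
| fp_starZ c x : fp_rel (FPstar (c [*:] x)) (c^* [*:] FPstar x)
| fp_starM x y : fp_rel (FPstar (x [*] y)) (FPstar y [*] FPstar x)
| fp_starK x : fp_rel (FPstar (FPstar x)) x
| fp_lD a a' : fp_rel (FPl (a + a')) (FPl a [+] FPl a')
| fp_lZ c a : fp_rel (FPl (c *: a)) (c [*:] FPl a)
| fp_lM a a' : fp_rel (FPl (smul a a')) (FPl a [*] FPl a')
| fp_l_star a : fp_rel (FPl (star a)) (FPstar (FPl a))
| fp_rD b b' : fp_rel (FPr (b + b')) (FPr b [+] FPr b')
| fp_rZ c b : fp_rel (FPr (c *: b)) (c [*:] FPr b)
| fp_rM b b' : fp_rel (FPr (smul b b')) (FPr b [*] FPr b')
| fp_r_star b : fp_rel (FPr (star b)) (FPstar (FPr b)).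

HB.instance Definition _ := gen_eqMixin fp_term.
HB.instance Definition _ := gen_choiceMixin fp_term.

Definition fp_relb (x y : fp_term) : bool := `[< fp_rel x y >].

Fact fp_relb_refl : reflexive fp_relb.
Proof. by move=> x; apply/asboolP/fp_refl. Qed.

Fact fp_relb_sym : symmetric fp_relb.
Proof. by move=> x y; apply/asboolP/asboolP => /fp_sym. Qed.

Fact fp_relb_trans : transitive fp_relb.
Proof.
by move=> y x z /asboolP xy /asboolP yz; apply/asboolP/(fp_trans xy yz).
Qed.

Canonical fp_equiv := EquivRel fp_relb fp_relb_refl fp_relb_sym fp_relb_trans.

Definition free_prod := {eq_quot fp_equiv}.
HB.instance Definition _ := Choice.on free_prod.
HB.instance Definition _ := Quotient.on free_prod.

Definition fp_cl (x : fp_term) : free_prod := \pi_free_prod x.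
Local Notation cl := fp_cl.

Fact free_prodW (P : free_prod -> Prop) : (forall x, P (cl x)) -> forall x, P x.
Proof. by move=> Pcl x; rewrite -[x]reprK; apply: Pcl. Qed.

Fact cl_eq x y : fp_rel x y -> cl x = cl y.
Proof. by move=> xy; apply/eqmodP/asboolP. Qed.

Fact repr_cl x : fp_rel (repr (cl x)) x.
Proof. by apply/asboolP; have /eqmodP := reprK (cl x). Qed.

Definition fp_add_op (x y : free_prod) : free_prod := cl (repr x [+] repr y).
Definition fp_scale_op (c : C) (x : free_prod) : free_prod := cl (c [*:] repr x).
Definition fp_mul_op (x y : free_prod) : free_prod := cl (repr x [*] repr y).
Definition fp_star_op (x : free_prod) : free_prod := cl (FPstar (repr x)).

Fact fp_addE x y : fp_add_op (cl x) (cl y) = cl (x [+] y).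
Proof. by apply/cl_eq/fp_congD; apply: repr_cl. Qed.
Fact fp_scaleE c x : fp_scale_op c (cl x) = cl (c [*:] x).
Proof. by apply/cl_eq/fp_congZ/repr_cl. Qed.
Fact fp_mulE x y : fp_mul_op (cl x) (cl y) = cl (x [*] y).
Proof. by apply/cl_eq/fp_congM; apply: repr_cl. Qed.
Fact fp_starE x : fp_star_op (cl x) = cl (FPstar x).
Proof. by apply/cl_eq/fp_cong_star/repr_cl. Qed.
Let opE := (fp_addE, fp_scaleE, fp_mulE, fp_starE).

Fact fp_opaddA : associative fp_add_op.
Proof.
elim/free_prodW=> x; elim/free_prodW=> y; elim/free_prodW=> z.
by rewrite !opE; apply/cl_eq/fp_addA.
Qed.
Fact fp_opaddC : commutative fp_add_op.
Proof.
by elim/free_prodW=> x; elim/free_prodW=> y; rewrite !opE; apply/cl_eq/fp_addC.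
Qed.
Fact fp_opadd0 : left_id (cl (FPl 0)) fp_add_op.
Proof. by elim/free_prodW=> x; rewrite !opE; apply/cl_eq/fp_add0. Qed.
Fact fp_opaddN : left_inverse (cl (FPl 0)) (fp_scale_op (-1)) fp_add_op.
Proof. by elim/free_prodW=> x; rewrite !opE; apply/cl_eq/fp_addN. Qed.

HB.instance Definition _ := GRing.isZmodule.Build free_prod
  fp_opaddA fp_opaddC fp_opadd0 fp_opaddN.

Fact fp_opscaleA c d x :
  fp_scale_op c (fp_scale_op d x) = fp_scale_op (c * d) x.
Proof. by elim/free_prodW: x => x; rewrite !opE; apply/cl_eq/fp_scaleA. Qed.
Fact fp_opscale1 : left_id 1 fp_scale_op.
Proof. by elim/free_prodW=> x; rewrite !opE; apply/cl_eq/fp_scale1. Qed.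
Fact fp_opscaleDr : right_distributive fp_scale_op +%R.
Proof.
move=> c; elim/free_prodW=> x; elim/free_prodW=> y; rewrite /GRing.add /= !opE.
exact/cl_eq/fp_scaleDr.
Qed.
Fact fp_opscaleDl x :
  {morph fp_scale_op^~ x : c d / (c + d)}.
Proof.
move=> c d; elim/free_prodW: x => x; rewrite /(GRing.add (fp_scale_op _ _)) /= !opE.
exact/cl_eq/fp_scaleDl.
Qed.

HB.instance Definition _ := GRing.Zmodule_isLmodule.Build C free_prod
  fp_opscaleA fp_opscale1 fp_opscaleDr fp_opscaleDl.

Fact cl_add x y : cl (x [+] y) = (cl x + cl y).
Proof. exact/esym/fp_addE. Qed.
Fact cl_scale c x : cl (c [*:] x) = (c *: cl x).
Proof. exact/esym/fp_scaleE. Qed.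

Fact fp_opmulA : associative fp_mul_op.
Proof.
elim/free_prodW=> x; elim/free_prodW=> y; elim/free_prodW=> z.
by rewrite !opE; apply/cl_eq/fp_mulA.
Qed.
Fact fp_opmulDl : left_distributive fp_mul_op +%R.
Proof.
elim/free_prodW=> x; elim/free_prodW=> y; elim/free_prodW=> z.
by rewrite -cl_add !fp_mulE -cl_add; apply/cl_eq/fp_mulDl.
Qed.
Fact fp_opmulDr : right_distributive fp_mul_op +%R.
Proof.
elim/free_prodW=> x; elim/free_prodW=> y; elim/free_prodW=> z.
by rewrite -cl_add !fp_mulE -cl_add; apply/cl_eq/fp_mulDr.
Qed.
Fact fp_opmulZl c x y :
  fp_mul_op (c *: x) y = (c *: fp_mul_op x y).
Proof.
elim/free_prodW: x => x; elim/free_prodW: y => y.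
by rewrite -cl_scale !fp_mulE -cl_scale; apply/cl_eq/fp_mulZl.
Qed.
Fact fp_opmulZr c x y :
  fp_mul_op x (c *: y) = (c *: fp_mul_op x y).
Proof.
elim/free_prodW: x => x; elim/free_prodW: y => y.
by rewrite -cl_scale !fp_mulE -cl_scale; apply/cl_eq/fp_mulZr.
Qed.
Fact fp_opstarD : {morph fp_star_op : x y / (x + y)}.
Proof.
elim/free_prodW=> x; elim/free_prodW=> y.
by rewrite -cl_add !fp_starE -cl_add; apply/cl_eq/fp_starD.
Qed.
Fact fp_opstarZ c x : fp_star_op (c *: x) = (c^* *: fp_star_op x).
Proof.
by elim/free_prodW: x => x; rewrite -cl_scale !fp_starE -cl_scale; apply/cl_eq/fp_starZ.
Qed.
Fact fp_opstarM x y :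
  fp_star_op (fp_mul_op x y) = fp_mul_op (fp_star_op y) (fp_star_op x).
Proof.
elim/free_prodW: x => x; elim/free_prodW: y => y.
by rewrite !opE; apply/cl_eq/fp_starM.
Qed.
Fact fp_opstarK : involutive fp_star_op.
Proof. by elim/free_prodW=> x; rewrite !opE; apply/cl_eq/fp_starK. Qed.

HB.instance Definition _ := Lmodule_isStarAlg.Build C free_prod
  fp_opmulA fp_opmulDl fp_opmulDr fp_opmulZl fp_opmulZr
  fp_opstarD fp_opstarZ fp_opstarM fp_opstarK.

Fact cl_mul x y : cl (x [*] y) = smul (cl x) (cl y).
Proof. exact/esym/fp_mulE. Qed.
Fact cl_star x : cl (FPstar x) = star (cl x).
Proof. exact/esym/fp_starE. Qed.

Definition fp_inl : starHom A free_prod.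
Proof.
exists (fun a => cl (FPl a)).
- by move=> c x y; rewrite -cl_scale -cl_add; apply/cl_eq/(fp_trans (fp_lD _ _))/fp_congD;
    [apply: fp_lZ | apply: fp_refl].
- by move=> x y; rewrite -cl_mul; apply/cl_eq/fp_lM.
- by move=> x; rewrite -cl_star; apply/cl_eq/fp_l_star.
Defined.

Definition fp_inr : starHom B free_prod.
Proof.
exists (fun b => cl (FPr b)).
- by move=> c x y; rewrite -cl_scale -cl_add; apply/cl_eq/(fp_trans (fp_rD _ _))/fp_congD;
    [apply: fp_rZ | apply: fp_refl].
- by move=> x y; rewrite -cl_mul; apply/cl_eq/fp_rM.
- by move=> x; rewrite -cl_star; apply/cl_eq/fp_r_star.
Defined.

Section Copair.
Variables (D : starAlgType C) (f : starHom A D) (g : starHom B D).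

Fixpoint fp_eval (t : fp_term) : D :=
  match t with
  | FPl a => f a
  | FPr b => g b
  | x [+] y => fp_eval x + fp_eval y
  | c [*:] x => c *: fp_eval x
  | x [*] y => smul (fp_eval x) (fp_eval y)
  | FPstar x => star (fp_eval x)
  end.

Fact fp_eval_rel x y : fp_rel x y -> fp_eval x = fp_eval y.
Proof.
elim=> //= {x y}; try by move=> *; congruence.
- by move=> *; rewrite addrA.
- by move=> *; rewrite addrC.
- by move=> x; rewrite hom0 add0r.
- by move=> x; rewrite hom0 scaleN1r addNr.
- by move=> *; rewrite scalerA.
- by move=> *; rewrite scale1r.
- by move=> *; rewrite scalerDr.
- by move=> *; rewrite scalerDl.
- by move=> *; rewrite smulA.
- by move=> *; rewrite smulDl.
- by move=> *; rewrite smulDr.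
- by move=> *; rewrite smulZl.
- by move=> *; rewrite smulZr.
- by move=> *; rewrite starD.
- by move=> *; rewrite starZ.
- by move=> *; rewrite starM.
- by move=> *; rewrite starK.
- by move=> *; rewrite homD.
- by move=> *; rewrite homZ.
- by move=> *; rewrite homM.
- by move=> *; rewrite hom_star.
- by move=> *; rewrite homD.
- by move=> *; rewrite homZ.
- by move=> *; rewrite homM.
- by move=> *; rewrite hom_star.
Qed.

Fact fp_eval_cl x : fp_eval (repr (cl x)) = fp_eval x.
Proof. exact/fp_eval_rel/repr_cl. Qed.

Definition fp_copair : starHom free_prod D.
Proof.
exists (fun x => fp_eval (repr x)).
- move=> c; elim/free_prodW=> x; elim/free_prodW=> y.
  by rewrite -cl_scale -cl_add !fp_eval_cl.
- by elim/free_prodW=> x; elim/free_prodW=> y; rewrite -cl_mul !fp_eval_cl.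
- by elim/free_prodW=> x; rewrite -cl_star !fp_eval_cl.
Defined.

Lemma fp_copair_inl a : fp_copair (fp_inl a) = f a.
Proof. exact: fp_eval_cl. Qed.

Lemma fp_copair_inr b : fp_copair (fp_inr b) = g b.
Proof. exact: fp_eval_cl. Qed.

End Copair.

Lemma fp_hom_ext (D : starAlgType C) (h k : starHom free_prod D) :
  (forall a, h (fp_inl a) = k (fp_inl a)) ->
  (forall b, h (fp_inr b) = k (fp_inr b)) -> h = k.
Proof.
move=> hkl hkr; apply: starHom_ext; elim/free_prodW; elim=> //.
- by move=> x hx y hy; rewrite cl_add !homD hx hy.
- by move=> c x hx; rewrite cl_scale !homZ hx.
- by move=> x hx y hy; rewrite cl_mul !homM hx hy.
- by move=> x hx; rewrite cl_star !hom_star hx.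
Qed.

End FreeProduct.

Arguments fp_inl {C A B}.
Arguments fp_inr {C A B}.

Definition fp_map (C : numClosedFieldType) (A1 A2 B1 B2 : starAlgType C)
    (j1 : starHom B1 A1) (j2 : starHom B2 A2) :
    starHom (free_prod B1 B2) (free_prod A1 A2) :=
  fp_copair (hom_comp fp_inl j1) (hom_comp fp_inr j2).

(* The canonical identification of the two iterated free products. *)
Definition fp_assoc (C : numClosedFieldType) (A1 A2 A3 : starAlgType C) :
    starHom (free_prod (free_prod A1 A2) A3) (free_prod A1 (free_prod A2 A3)) :=
  fp_copair (fp_copair fp_inl (hom_comp fp_inr fp_inl)) (hom_comp fp_inr fp_inr).

HB.mixin Record Lmodule_isPreHilb (C : numClosedFieldType) H
    of GRing.Lmodule C H := {
  inner : {dot H for conjC};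
  vac : H;
  vac_unit : inner vac vac = 1
}.

#[short(type="preHilbType")]
HB.structure Definition PreHilb (C : numClosedFieldType) :=
  { H of GRing.Lmodule C H & Lmodule_isPreHilb C H }.

Record arrow (C : numClosedFieldType) (H G : preHilbType C) := Arrow {
  arrow_fun :> H -> G;
  arrow_linear : linear arrow_fun;
  arrow_isometry : isometry (@inner C G) (@inner C H) arrow_fun;
  arrow_vac : arrow_fun (@vac C H) = @vac C G
}.

Section PreHilbCategory.
Variable C : numClosedFieldType.

Definition arr_id (H : preHilbType C) : arrow H H.
Proof. by exists id. Defined.

Definition arr_comp (H G K : preHilbType C) (V : arrow G K) (W : arrow H G) :
  arrow H K.
Proof.
exists (V \o W).
- by move=> c x y /=; rewrite !arrow_linear.
- by move=> x y /=; rewrite !arrow_isometry.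
- by rewrite /= !arrow_vac.
Defined.

Lemma arrow_ext (H G : preHilbType C) (V W : arrow H G) : V =1 W -> V = W.
Proof.
case: V W => [f f1 f2 f3] [g g1 g2 g3] /= /funext fg; rewrite -fg in g1 g2 g3 *.
by congr Arrow; apply: Prop_irrelevance.
Qed.

End PreHilbCategory.

Record arr_iso (C : numClosedFieldType) (H G : preHilbType C) := ArrIso {
  iso_fun :> arrow H G;
  iso_inv : arrow G H;
  iso_funK : arr_comp iso_inv iso_fun = arr_id H;
  iso_invK : arr_comp iso_fun iso_inv = arr_id G
}.

Section Adjointable.
Variables (C : numClosedFieldType) (H : preHilbType C).

(* The adjoint is determined by the operator, so carrying it as a field adds  *)
(* no data: see [adjointable_ext].                                            *)
Record adjointable := Adjointable {
  opr :> H -> H;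
  adj : H -> H;
  opr_linear : linear opr;
  adjP : forall x y, inner (opr x) y = inner x (adj y)
}.

Implicit Types (T S : adjointable) (x y : H).

Fact inner_ext x y : (forall z, inner z x = inner z y) -> x = y.
Proof.
move=> xy; apply/eqP; rewrite -subr_eq0; apply/negP => /negP xy0.
have := neq0_dnorm_gt0 (s := inner) _ xy0.
by rewrite linearB /= xy subrr ltxx.
Qed.

Fact inner_conj x y : inner x y = (inner y x)^*.
Proof. by have := hermitian_subproof (s := @inner C H) x y; rewrite mul1r. Qed.

Fact inner_DZl c x y z : inner (c *: x + y) z = c * inner x z + inner y z.
Proof. by rewrite inner_conj linearP /= rmorphD rmorphM /= conjCK -!inner_conj. Qed.

Fact inner_DZr c x y z : inner z (c *: x + y) = c^* * inner z x + inner z y.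
Proof. exact: linearP. Qed.

Lemma adjointable_ext T S : T =1 S -> T = S.
Proof.
case: T S => [f f' f1 f2] [g g' g1 g2] /= /funext fg; rewrite -fg in g1 g2 *.
have /funext f'g' : f' =1 g' by move=> y; apply: inner_ext => z; rewrite -f2 g2.
rewrite -f'g' in g2 *.
by congr Adjointable; apply: Prop_irrelevance.
Qed.

Fact adj_linear T : linear (adj T).
Proof.
by move=> c x y; apply: inner_ext => z; rewrite -adjP !inner_DZr !adjP.
Qed.

Fact adj_adj T x y : inner (adj T x) y = inner x (T y).
Proof. by rewrite inner_conj -adjP -inner_conj. Qed.

HB.instance Definition _ := gen_eqMixin adjointable.
HB.instance Definition _ := gen_choiceMixin adjointable.

Definition opr_zero : adjointable.
Proof.
exists (fun=> 0) (fun=> 0).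
- by move=> c x y; rewrite scaler0 addr0.
- by move=> x y; rewrite raddf0 inner_conj raddf0 rmorph0.
Defined.

Definition opr_comb (c : C) T S : adjointable.
Proof.
exists (fun x => c *: T x + S x) (fun x => c^* *: adj T x + adj S x).
- move=> d x y; rewrite !opr_linear !scalerDr !scalerA mulrC -!addrA.
  by congr (_ + _); rewrite addrCA.
- by move=> x y; rewrite inner_DZl inner_DZr conjCK !adjP.
Defined.

Definition opr_mul T S : adjointable.
Proof.
exists (T \o S) (adj S \o adj T).
- by move=> c x y /=; rewrite !opr_linear.
- by move=> x y /=; rewrite !adjP.
Defined.

Definition opr_star T : adjointable :=
  Adjointable (@adj_linear T) (@adj_adj T).

Let addT T S := opr_comb 1 T S.
Let oppT T := opr_comb (-1) T opr_zero.
Let scaleT c T := opr_comb c T opr_zero.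

Fact opr_addA : associative addT.
Proof. by move=> T S U; apply: adjointable_ext => x /=; rewrite !scale1r addrA. Qed.
Fact opr_addC : commutative addT.
Proof. by move=> T S; apply: adjointable_ext => x /=; rewrite !scale1r addrC. Qed.
Fact opr_add0 : left_id opr_zero addT.
Proof. by move=> T; apply: adjointable_ext => x /=; rewrite scaler0 add0r. Qed.
Fact opr_addN : left_inverse opr_zero oppT addT.
Proof.
by move=> T; apply: adjointable_ext => x /=; rewrite scale1r addr0 scaleN1r addNr.
Qed.

HB.instance Definition _ := GRing.isZmodule.Build adjointable
  opr_addA opr_addC opr_add0 opr_addN.

Lemma oprD T S x : (T + S) x = T x + S x.
Proof. by rewrite /= scale1r. Qed.

Fact opr_scaleA c d T : scaleT c (scaleT d T) = scaleT (c * d) T.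
Proof. by apply: adjointable_ext => x /=; rewrite !addr0 scalerA. Qed.
Fact opr_scale1 : left_id 1 scaleT.
Proof. by move=> T; apply: adjointable_ext => x /=; rewrite addr0 scale1r. Qed.
Fact opr_scaleDr : right_distributive scaleT +%R.
Proof.
move=> c T S; apply: adjointable_ext => x.
by rewrite oprD /= !addr0 scale1r scalerDr.
Qed.
Fact opr_scaleDl T : {morph scaleT^~ T : c d / c + d}.
Proof.
by move=> c d; apply: adjointable_ext => x; rewrite oprD /= !addr0 scalerDl.
Qed.

HB.instance Definition _ := GRing.Zmodule_isLmodule.Build C adjointable
  opr_scaleA opr_scale1 opr_scaleDr opr_scaleDl.

Lemma oprZ c T x : (c *: T) x = c *: T x.
Proof. by rewrite /= addr0. Qed.

Fact opr_mulA : associative opr_mul.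
Proof. by move=> T S U; apply: adjointable_ext. Qed.
Fact opr_mulDl : left_distributive opr_mul +%R.
Proof. by move=> T S U; apply: adjointable_ext => x; rewrite oprD /= scale1r. Qed.
Fact opr_mulDr : right_distributive opr_mul +%R.
Proof.
by move=> T S U; apply: adjointable_ext => x; rewrite oprD /= opr_linear scale1r.
Qed.
Fact opr_mulZl c T S : opr_mul (c *: T) S = c *: opr_mul T S.
Proof. by apply: adjointable_ext => x. Qed.
Fact opr_mulZr c T S : opr_mul T (c *: S) = c *: opr_mul T S.
Proof.
apply: adjointable_ext => x; rewrite oprZ /= addr0 -[c *: S x]addr0 opr_linear.
suff -> : T 0 = 0 by rewrite addr0.
have := opr_linear T 1 0 0; rewrite !scale1r !addr0 => T00.
by apply: (addrI (T 0)); rewrite -T00 addr0.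
Qed.
Fact opr_starD : {morph opr_star : T S / T + S}.
Proof.
by move=> T S; apply: adjointable_ext => x; rewrite oprD /= conjC1 scale1r.
Qed.
Fact opr_starZ c T : opr_star (c *: T) = c^* *: opr_star T.
Proof. by apply: adjointable_ext => x; rewrite oprZ /= addr0. Qed.
Fact opr_starM T S : opr_star (opr_mul T S) = opr_mul (opr_star S) (opr_star T).
Proof. exact: adjointable_ext. Qed.
Fact opr_starK : involutive opr_star.
Proof. by move=> T; apply: adjointable_ext. Qed.

HB.instance Definition _ := Lmodule_isStarAlg.Build C adjointable
  opr_mulA opr_mulDl opr_mulDr opr_mulZl opr_mulZr
  opr_starD opr_starZ opr_starM opr_starK.

End Adjointable.

Notation La H := (adjointable H : starAlgType _).

Record monoidal_product (C : numClosedFieldType) := MonoidalProduct {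
  box : preHilbType C -> preHilbType C -> preHilbType C;
  boxm : forall H1 H2 G1 G2 : preHilbType C,
    arrow H1 G1 -> arrow H2 G2 -> arrow (box H1 H2) (box G1 G2);
  boxm_id : forall H1 H2, boxm (arr_id H1) (arr_id H2) = arr_id (box H1 H2);
  boxm_comp : forall H1 H2 G1 G2 K1 K2 (V1 : arrow G1 K1) (V2 : arrow G2 K2)
      (W1 : arrow H1 G1) (W2 : arrow H2 G2),
    boxm (arr_comp V1 W1) (arr_comp V2 W2) =
      arr_comp (boxm V1 V2) (boxm W1 W2);
  box1 : preHilbType C;
  assoc : forall H1 H2 H3,
    arr_iso (box (box H1 H2) H3) (box H1 (box H2 H3));
  lunit : forall H, arr_iso (box box1 H) H;
  runit : forall H, arr_iso (box H box1) H;
  assoc_nat : forall H1 H2 H3 G1 G2 G3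
      (W1 : arrow H1 G1) (W2 : arrow H2 G2) (W3 : arrow H3 G3),
    arr_comp (assoc G1 G2 G3) (boxm (boxm W1 W2) W3) =
      arr_comp (boxm W1 (boxm W2 W3)) (assoc H1 H2 H3);
  lunit_nat : forall H G (W : arrow H G),
    arr_comp (lunit G) (boxm (arr_id box1) W) = arr_comp W (lunit H);
  runit_nat : forall H G (W : arrow H G),
    arr_comp (runit G) (boxm W (arr_id box1)) = arr_comp W (runit H);
  pentagon : forall H1 H2 H3 H4,
    arr_comp (assoc H1 H2 (box H3 H4)) (assoc (box H1 H2) H3 H4) =
      arr_comp (boxm (arr_id H1) (assoc H2 H3 H4))
        (arr_comp (assoc H1 (box H2 H3) H4)
                  (boxm (assoc H1 H2 H3) (arr_id H4)));
  triangle : forall H1 H2,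
    arr_comp (boxm (arr_id H1) (lunit H2)) (assoc H1 box1 H2) =
      boxm (runit H1) (arr_id H2);
  box1_arrow : forall H, arrow box1 H;
  box1_initial : forall H (W : arrow box1 H), W = box1_arrow H
}.

Arguments assoc {C} m H1 H2 H3.
Arguments box1_arrow {C} m H.
Arguments lunit {C} m H.
Arguments runit {C} m H.

Section Products.
Variables (C : numClosedFieldType) (M : monoidal_product C).

Local Notation "H1 [x] H2" := (box M H1 H2) (at level 40, left associativity).

Definition emb_l (H1 H2 : preHilbType C) : arrow H1 (H1 [x] H2) :=
  arr_comp (boxm M (arr_id H1) (box1_arrow M H2)) (iso_inv (runit M H1)).

Definition emb_r (H1 H2 : preHilbType C) : arrow H2 (H1 [x] H2) :=
  arr_comp (boxm M (box1_arrow M H1) (arr_id H2)) (iso_inv (lunit M H2)).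

(* An equation between operators on H1 [x] (H2 [x] H3) and on                 *)
(* (H1 [x] H2) [x] H3 is stated as intertwining by the associator.            *)

Record is_left_lift
    (lam : forall H1 H2 : preHilbType C, starHom (La H1) (La (H1 [x] H2))) :
    Prop := {
  left_lift_assoc : forall (H1 H2 H3 : preHilbType C) (T : La H1) x,
    lam H1 (H2 [x] H3) T (assoc M H1 H2 H3 x) =
      assoc M H1 H2 H3 (lam (H1 [x] H2) H3 (lam H1 H2 T) x);
  left_lift_univ : forall (H1 H2 G1 G2 : preHilbType C) (T : La H1) (S : La G1)
      (W1 : arrow H1 G1) (W2 : arrow H2 G2),
    (forall x, W1 (T x) = S (W1 x)) ->
    (forall x, W1 (adj T x) = adj S (W1 x)) ->
    forall x, boxm M W1 W2 (lam H1 H2 T x) = lam G1 G2 S (boxm M W1 W2 x);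
  left_lift_restr : forall (H1 H2 : preHilbType C) (T : La H1) x,
    lam H1 H2 T (emb_l H1 H2 x) = emb_l H1 H2 (T x)
}.

Record is_right_lift
    (rho : forall H1 H2 : preHilbType C, starHom (La H2) (La (H1 [x] H2))) :
    Prop := {
  right_lift_assoc : forall (H1 H2 H3 : preHilbType C) (T : La H3) x,
    rho H1 (H2 [x] H3) (rho H2 H3 T) (assoc M H1 H2 H3 x) =
      assoc M H1 H2 H3 (rho (H1 [x] H2) H3 T x);
  right_lift_univ : forall (H1 H2 G1 G2 : preHilbType C) (T : La H2) (S : La G2)
      (W1 : arrow H1 G1) (W2 : arrow H2 G2),
    (forall x, W2 (T x) = S (W2 x)) ->
    (forall x, W2 (adj T x) = adj S (W2 x)) ->
    forall x, boxm M W1 W2 (rho H1 H2 T x) = rho G1 G2 S (boxm M W1 W2 x);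
  right_lift_restr : forall (H1 H2 : preHilbType C) (T : La H2) x,
    rho H1 H2 T (emb_r H1 H2 x) = emb_r H1 H2 (T x)
}.

Record universal_lift := UniversalLift {
  lam : forall H1 H2 : preHilbType C, starHom (La H1) (La (H1 [x] H2));
  rho : forall H1 H2 : preHilbType C, starHom (La H2) (La (H1 [x] H2));
  lam_left : is_left_lift lam;
  rho_right : is_right_lift rho;
  middle_assoc : forall (H1 H2 H3 : preHilbType C) (T : La H2) x,
    rho H1 (H2 [x] H3) (lam H2 H3 T) (assoc M H1 H2 H3 x) =
      assoc M H1 H2 H3 (lam (H1 [x] H2) H3 (rho H1 H2 T) x)
}.

Record universal_product := UniversalProduct {
  odot : forall (A1 A2 : starAlgType C) (H1 H2 : preHilbType C),
    starHom A1 (La H1) -> starHom A2 (La H2) ->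
    starHom (free_prod A1 A2) (La (H1 [x] H2));
  odot_assoc : forall (A1 A2 A3 : starAlgType C) (H1 H2 H3 : preHilbType C)
      (p1 : starHom A1 (La H1)) (p2 : starHom A2 (La H2))
      (p3 : starHom A3 (La H3)) a x,
    odot p1 (odot p2 p3) (fp_assoc A1 A2 A3 a) (assoc M H1 H2 H3 x) =
      assoc M H1 H2 H3 (odot (odot p1 p2) p3 a x);
  odot_univ_alg : forall (A1 A2 B1 B2 : starAlgType C) (H1 H2 : preHilbType C)
      (p1 : starHom A1 (La H1)) (p2 : starHom A2 (La H2))
      (j1 : starHom B1 A1) (j2 : starHom B2 A2),
    hom_comp (odot p1 p2) (fp_map j1 j2) =
      odot (hom_comp p1 j1) (hom_comp p2 j2);
  odot_univ_space : forall (A1 A2 : starAlgType C) (H1 H2 G1 G2 : preHilbType C)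
      (W1 : arrow H1 G1) (W2 : arrow H2 G2)
      (p1 : starHom A1 (La H1)) (p2 : starHom A2 (La H2))
      (s1 : starHom A1 (La G1)) (s2 : starHom A2 (La G2)),
    (forall a x, W1 (p1 a x) = s1 a (W1 x)) ->
    (forall a x, W2 (p2 a x) = s2 a (W2 x)) ->
    forall a x, boxm M W1 W2 (odot p1 p2 a x) = odot s1 s2 a (boxm M W1 W2 x);
  odot_restr_l : forall (A1 A2 : starAlgType C) (H1 H2 : preHilbType C)
      (p1 : starHom A1 (La H1)) (p2 : starHom A2 (La H2)) a x,
    odot p1 p2 (fp_inl a) (emb_l H1 H2 x) = emb_l H1 H2 (p1 a x);
  odot_restr_r : forall (A1 A2 : starAlgType C) (H1 H2 : preHilbType C)
      (p1 : starHom A1 (La H1)) (p2 : starHom A2 (La H2)) a x,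
    odot p1 p2 (fp_inr a) (emb_r H1 H2 x) = emb_r H1 H2 (p2 a x)
}.

End Products.

(* Main.v *)
From HB Require Import structures.
Require Import Defs.
From mathcomp Require Import all_boot all_order all_algebra.
From mathcomp Require Import complex reals.
From mathcomp Require Import boolp.

Set Implicit Arguments.
Unset Strict Implicit.
Unset Printing Implicit Defensive.

(* A universal product is determined by its value on identity representations *)
(* because [pi1 (.) pi2 = (id (.) id) o (pi1 |_| pi2)]; its components there  *)
(* are the two lifts, and conversely.  The one mismatch between the two sets  *)
(* of axioms is that lifts are natural with respect to a single intertwined   *)
(* pair of operators [(T, S)], whereas products ask for two representations   *)
(* of one *-algebra.  It is bridged by the *-algebra of all pairs [(T, S)]    *)
(* such that an arrow [W] intertwines [T] with [S] and [T^*] with [S^*],      *)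
(* represented by its two projections.                                        *)

Import GRing.Theory Num.Theory.

Local Open Scope ring_scope.

(** A representation of a free product is the same as a pair of representations of its factors. By
    universality of *-algebras ([odot_map]) a product is therefore recovered from its restrictions
    at identity representations, and these are its lifts. Tested on three free factors,
    associativity splits into left, middle and right associativity of lifts. The universality axioms
    match because the pairs of operators that an arrow intertwines, together with their adjoints,
    form a *-algebra: intertwining need only be checked on generators ([fp_intertwine]), and each
    such pair is a value of two representations of one *-algebra. *)

Section StarAlgTheory.
Variable C : numClosedFieldType.

Lemma star0 (A : starAlgType C) : star 0 = 0 :> A.
Proof. by rewrite -[X in star X](scaler0 _ 0) starZ conjC0 scale0r. Qed.

Lemma smul0 (A : starAlgType C) (x : A) : smul 0 x = 0.
Proof. by rewrite -[X in smul X](scaler0 _ 0) smulZl scale0r. Qed.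

Lemma hom_compE (A B D : starAlgType C) (g : starHom B D) (f : starHom A B) x :
  hom_comp g f x = g (f x).
Proof. by []. Qed.

(** Admissible because homomorphisms need not preserve units. It fills the idle factor when a
    product is used to study one lift only. *)
Definition hom_zero (A B : starAlgType C) : starHom A B.
Proof.
exists (fun=> 0).
- by move=> c x y; rewrite scaler0 addr0.
- by move=> x y; rewrite smul0.
- by move=> x; rewrite star0.
Defined.

Lemma fp_mapl (A1 A2 B1 B2 : starAlgType C) (j1 : starHom B1 A1)
    (j2 : starHom B2 A2) b : fp_map j1 j2 (fp_inl b) = fp_inl (j1 b).
Proof. exact: fp_copair_inl. Qed.

Lemma fp_mapr (A1 A2 B1 B2 : starAlgType C) (j1 : starHom B1 A1)
    (j2 : starHom B2 A2) b : fp_map j1 j2 (fp_inr b) = fp_inr (j2 b).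
Proof. exact: fp_copair_inr. Qed.

Lemma fp_assoc_inll (A1 A2 A3 : starAlgType C) a :
  fp_assoc A1 A2 A3 (fp_inl (fp_inl a)) = fp_inl a.
Proof. by rewrite /fp_assoc !fp_copair_inl. Qed.

Lemma fp_assoc_inlr (A1 A2 A3 : starAlgType C) a :
  fp_assoc A1 A2 A3 (fp_inl (fp_inr a)) = fp_inr (fp_inl a).
Proof. by rewrite /fp_assoc fp_copair_inl fp_copair_inr. Qed.

Lemma fp_assoc_inr (A1 A2 A3 : starAlgType C) a :
  fp_assoc A1 A2 A3 (fp_inr a) = fp_inr (fp_inr a).
Proof. by rewrite /fp_assoc fp_copair_inr. Qed.

End StarAlgTheory.

(** * The *-algebra of pairs of operators intertwined by an arrow *)

Section Intertwiners.
Variables (C : numClosedFieldType) (H G : preHilbType C) (W : arrow H G).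

Lemma arrowD x y : W (x + y) = W x + W y.
Proof. by rewrite -[x]scale1r arrow_linear !scale1r. Qed.

Lemma arrow0 : W 0 = 0.
Proof. by apply: (addrI (W 0)); rewrite -arrowD !addr0. Qed.

(** The second clause does not follow from the first: an invariant subspace of [S] need not be
    invariant under its adjoint. *)
Definition intertwines (T : La H) (S : La G) : Prop :=
  (forall x, W (T x) = S (W x)) /\ (forall x, W (adj T x) = adj S (W x)).

Definition intertwined : {pred La H * La G} :=
  fun p => `[< intertwines p.1 p.2 >].

Fact intertwined_submod : submod_closed intertwined.
Proof.
split=> [|c [T S] [T' S'] /asboolP[/= TS TS'] /asboolP[/= US US']];
  apply/asboolP; split=> x /=; rewrite ?arrow0 //.
(* Sums and multiples in [La] unfold to [opr_comb], hence the stray factors [1] and summands [0]. *)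
- by rewrite !scale1r !addr0 arrowD -US -TS -[c *: T x]addr0 arrow_linear arrow0 addr0.
- rewrite conjC1 !scale1r !addr0 arrowD -US' -TS'.
  by rewrite -[_ *: adj T x]addr0 arrow_linear arrow0 addr0.
Qed.
HB.instance Definition _ :=
  GRing.isSubmodClosed.Build C (La H * La G)%type intertwined intertwined_submod.

Record intertwined_pair := IntertwinedPair {
  pair_val :> La H * La G;
  _ : pair_val \in intertwined
}.
HB.instance Definition _ := [isSub for pair_val].
HB.instance Definition _ := [Choice of intertwined_pair by <:].
HB.instance Definition _ := [SubChoice_isSubLmodule of intertwined_pair by <:].


Implicit Types p q : intertwined_pair.

Lemma pairP p : intertwines (pair_val p).1 (pair_val p).2.
Proof. exact/asboolP/(valP p). Qed.

Definition pair_smul p q : intertwined_pair.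
Proof.
exists (smul (pair_val p).1 (pair_val q).1, smul (pair_val p).2 (pair_val q).2).
have [[p1 p2] [q1 q2]] := (pairP p, pairP q).
by apply/asboolP; split=> x /=; rewrite ?p1 ?q1 ?q2 ?p2.
Defined.

Definition pair_star p : intertwined_pair.
Proof.
exists (star (pair_val p).1, star (pair_val p).2).
by have [p1 p2] := pairP p; apply/asboolP; split=> x /=; rewrite ?p1 ?p2.
Defined.

Fact pair_smulA : associative pair_smul.
Proof. by move=> p q r; apply: val_inj; rewrite /= !smulA. Qed.
Fact pair_smulDl : left_distributive pair_smul +%R.
Proof. by move=> p q r; apply: val_inj; rewrite /= !smulDl. Qed.
Fact pair_smulDr : right_distributive pair_smul +%R.
Proof. by move=> p q r; apply: val_inj; rewrite /= !smulDr. Qed.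
Fact pair_smulZl c p q : pair_smul (c *: p) q = c *: pair_smul p q.
Proof. by apply: val_inj; rewrite /= !smulZl. Qed.
Fact pair_smulZr c p q : pair_smul p (c *: q) = c *: pair_smul p q.
Proof. by apply: val_inj; rewrite /= !smulZr. Qed.
Fact pair_starD : {morph pair_star : p q / p + q}.
Proof. by move=> p q; apply: val_inj; rewrite /= !starD. Qed.
Fact pair_starZ c p : pair_star (c *: p) = c^* *: pair_star p.
Proof. by apply: val_inj; rewrite /= !starZ. Qed.
Fact pair_starM p q :
  pair_star (pair_smul p q) = pair_smul (pair_star q) (pair_star p).
Proof. by apply: val_inj; rewrite /= !starM. Qed.
Fact pair_starK : involutive pair_star.
Proof. by move=> p; apply: val_inj; rewrite /= !starK; case: (\val p). Qed.

HB.instance Definition _ := Lmodule_isStarAlg.Build C intertwined_pair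
  pair_smulA pair_smulDl pair_smulDr pair_smulZl pair_smulZr
  pair_starD pair_starZ pair_starM pair_starK.

Definition pair_fst : starHom intertwined_pair (La H).
Proof. by exists (fun p => (pair_val p).1). Defined.

Definition pair_snd : starHom intertwined_pair (La G).
Proof. by exists (fun p => (pair_val p).2). Defined.

Lemma pair_fst_snd p x : W (pair_fst p x) = pair_snd p (W x).
Proof. by have [->] := pairP p. Qed.

(** For a whole representation the adjoint clause comes for free: apply [hk] to [star a]. *)
Fact hom_pair_subproof (A : starAlgType C) (h : starHom A (La H))
    (k : starHom A (La G)) (hk : forall a x, W (h a x) = k a (W x)) a :
  (h a, k a) \in intertwined.
Proof.
apply/asboolP; split=> x //=.
by have := hk (star a) x; rewrite !hom_star.
Qed.

Definition hom_pair (A : starAlgType C) (h : starHom A (La H))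
  (k : starHom A (La G)) (hk : forall a x, W (h a x) = k a (W x)) :
  starHom A intertwined_pair.
Proof.
exists (fun a => IntertwinedPair (hom_pair_subproof hk a)).
- by move=> c x y; apply: val_inj; rewrite /= !hom_linear.
- by move=> x y; apply: val_inj; rewrite /= !homM.
- by move=> x; apply: val_inj; rewrite /= !hom_star.
Defined.

(* [h] and [k] are the two components of a *-homomorphism into the algebra of *)
(* intertwined pairs, so it is enough to look at generators.                  *)
Lemma fp_intertwine (A B : starAlgType C) (h : starHom (free_prod A B) (La H))
    (k : starHom (free_prod A B) (La G)) :
  (forall a x, W (h (fp_inl a) x) = k (fp_inl a) (W x)) ->
  (forall b x, W (h (fp_inr b) x) = k (fp_inr b) (W x)) ->
  forall c x, W (h c x) = k c (W x).
Proof.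
move=> hkl hkr c x.
pose l := @hom_pair A (hom_comp h fp_inl) (hom_comp k fp_inl) hkl.
pose r := @hom_pair B (hom_comp h fp_inr) (hom_comp k fp_inr) hkr.
have -> : h = hom_comp pair_fst (fp_copair l r).
  by apply: fp_hom_ext => d; rewrite hom_compE ?(fp_copair_inl, fp_copair_inr).
have -> : k = hom_comp pair_snd (fp_copair l r).
  by apply: fp_hom_ext => d; rewrite hom_compE ?(fp_copair_inl, fp_copair_inr).
exact: pair_fst_snd.
Qed.

End Intertwiners.

(** * From products to lifts *)

Section LiftOfProduct.
Variables (C : numClosedFieldType) (M : monoidal_product C).
Variable P : universal_product M.

Local Notation "H1 [x] H2" := (box M H1 H2) (at level 40, left associativity).

Definition odot_id (H1 H2 : preHilbType C) :
    starHom (free_prod (La H1) (La H2)) (La (H1 [x] H2)) :=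
  odot P (hom_id (La H1)) (hom_id (La H2)).

Definition prod_lam (H1 H2 : preHilbType C) : starHom (La H1) (La (H1 [x] H2)) :=
  hom_comp (odot_id H1 H2) fp_inl.

Definition prod_rho (H1 H2 : preHilbType C) : starHom (La H2) (La (H1 [x] H2)) :=
  hom_comp (odot_id H1 H2) fp_inr.

(** Universality of *-algebras for identity representations, with the representations themselves as
    the homomorphisms [j1] and [j2]. *)
Lemma odot_map (A1 A2 : starAlgType C) (H1 H2 : preHilbType C)
    (p1 : starHom A1 (La H1)) (p2 : starHom A2 (La H2)) a :
  odot P p1 p2 a = odot_id H1 H2 (fp_map p1 p2 a).
Proof.
rewrite -hom_compE odot_univ_alg; congr (odot P _ _ a); exact: starHom_ext.
Qed.

Lemma odot_inl (A1 A2 : starAlgType C) (H1 H2 : preHilbType C)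
    (p1 : starHom A1 (La H1)) (p2 : starHom A2 (La H2)) a :
  odot P p1 p2 (fp_inl a) = prod_lam H1 H2 (p1 a).
Proof. by rewrite odot_map fp_mapl. Qed.

Lemma odot_inr (A1 A2 : starAlgType C) (H1 H2 : preHilbType C)
    (p1 : starHom A1 (La H1)) (p2 : starHom A2 (La H2)) a :
  odot P p1 p2 (fp_inr a) = prod_rho H1 H2 (p2 a).
Proof. by rewrite odot_map fp_mapr. Qed.

(* The three lift associativities are [odot_assoc] for identity               *)
(* representations, read on the three free factors.                           *)
Let odot_id_assoc (H1 H2 H3 : preHilbType C) a x :
  odot P (hom_id (La H1)) (odot_id H2 H3) (fp_assoc _ _ _ a)
      (assoc M H1 H2 H3 x) =
    assoc M H1 H2 H3 (odot P (odot_id H1 H2) (hom_id (La H3)) a x).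
Proof. exact: odot_assoc. Qed.

Lemma prod_lam_left : is_left_lift prod_lam.
Proof.
split=> [H1 H2 H3 T x|H1 H2 G1 G2 T S W1 W2 TS TS'|H1 H2 T x].
- have := odot_id_assoc (fp_inl (fp_inl T)) x.
  by rewrite fp_assoc_inll !odot_inl.
(* The first factor is the algebra of intertwined pairs with its two projections. The second carries
   zero representations, which [W2] intertwines trivially. *)
- have pTS : (T, S) \in intertwined W1 by apply/asboolP.
  pose p := IntertwinedPair pTS => x.
  have := @odot_univ_space _ _ P _ _ _ _ _ _ W1 W2 (pair_fst W1)
    (hom_zero (intertwined_pair W1) _) (pair_snd W1) (hom_zero _ _)
    (@pair_fst_snd _ _ _ W1) (fun _ _ => arrow0 W2) (fp_inl p) x.
  by rewrite !odot_inl.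
- exact: odot_restr_l.
Qed.

Lemma prod_rho_right : is_right_lift prod_rho.
Proof.
split=> [H1 H2 H3 T x|H1 H2 G1 G2 T S W1 W2 TS TS'|H1 H2 T x].
- have := odot_id_assoc (fp_inr T) x.
  by rewrite fp_assoc_inr !odot_inr.
- have pTS : (T, S) \in intertwined W2 by apply/asboolP.
  pose p := IntertwinedPair pTS => x.
  have := @odot_univ_space _ _ P _ _ _ _ _ _ W1 W2
    (hom_zero (intertwined_pair W2) _) (pair_fst W2) (hom_zero _ _) (pair_snd W2)
    (fun _ _ => arrow0 W1) (@pair_fst_snd _ _ _ W2) (fp_inr p) x.
  by rewrite !odot_inr.
- exact: odot_restr_r.
Qed.

Lemma prod_middle_assoc (H1 H2 H3 : preHilbType C) (T : La H2) x :
  prod_rho H1 (H2 [x] H3) (prod_lam H2 H3 T) (assoc M H1 H2 H3 x) =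
    assoc M H1 H2 H3 (prod_lam (H1 [x] H2) H3 (prod_rho H1 H2 T) x).
Proof.
have := odot_id_assoc (fp_inl (fp_inr T)) x.
by rewrite fp_assoc_inlr odot_inl odot_inr.
Qed.

Definition lift_of_product : universal_lift M :=
  UniversalLift prod_lam_left prod_rho_right prod_middle_assoc.

End LiftOfProduct.

(** * From lifts to products *)

Section ProductOfLift.
Variables (C : numClosedFieldType) (M : monoidal_product C).
Variable L : universal_lift M.

Definition lift_odot (A1 A2 : starAlgType C) (H1 H2 : preHilbType C)
    (p1 : starHom A1 (La H1)) (p2 : starHom A2 (La H2)) :
    starHom (free_prod A1 A2) (La (box M H1 H2)) :=
  fp_copair (hom_comp (lam L H1 H2) p1) (hom_comp (rho L H1 H2) p2).

Lemma lift_odot_inl (A1 A2 : starAlgType C) (H1 H2 : preHilbType C)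
    (p1 : starHom A1 (La H1)) (p2 : starHom A2 (La H2)) a :
  lift_odot p1 p2 (fp_inl a) = lam L H1 H2 (p1 a).
Proof. exact: fp_copair_inl. Qed.

Lemma lift_odot_inr (A1 A2 : starAlgType C) (H1 H2 : preHilbType C)
    (p1 : starHom A1 (La H1)) (p2 : starHom A2 (La H2)) a :
  lift_odot p1 p2 (fp_inr a) = rho L H1 H2 (p2 a).
Proof. exact: fp_copair_inr. Qed.

(** The associator is itself an arrow, so the claim is an intertwining relation; on generators from
    [A1], [A2], [A3] it is left, middle and right associativity. *)
Lemma lift_odot_assoc (A1 A2 A3 : starAlgType C) (H1 H2 H3 : preHilbType C)
    (p1 : starHom A1 (La H1)) (p2 : starHom A2 (La H2))
    (p3 : starHom A3 (La H3)) a x :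
  lift_odot p1 (lift_odot p2 p3) (fp_assoc A1 A2 A3 a) (assoc M H1 H2 H3 x) =
    assoc M H1 H2 H3 (lift_odot (lift_odot p1 p2) p3 a x).
Proof.
pose h := hom_comp (lift_odot p1 (lift_odot p2 p3)) (fp_assoc A1 A2 A3).
pose k := lift_odot (lift_odot p1 p2) p3.
suff hk : forall a x, assoc M H1 H2 H3 (k a x) = h a (assoc M H1 H2 H3 x).
  by rewrite hk.
apply: fp_intertwine => [a12|a3] {a}x; last first.
  rewrite /h /k hom_compE fp_assoc_inr !lift_odot_inr.
  by rewrite (right_lift_assoc (rho_right L)).
(* The generator [a12] lies in a free product in its turn, so the reduction is repeated on the
   restrictions to it. *)
apply: (fp_intertwine (h := hom_comp k fp_inl) (k := hom_comp h fp_inl))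
  => [a1|a2] {a12}x.
- rewrite /h /k !hom_compE fp_assoc_inll !lift_odot_inl.
  by rewrite (left_lift_assoc (lam_left L)).
- rewrite /h /k !hom_compE fp_assoc_inlr.
  by rewrite lift_odot_inl !lift_odot_inr lift_odot_inl middle_assoc.
Qed.

Lemma lift_odot_univ_alg (A1 A2 B1 B2 : starAlgType C) (H1 H2 : preHilbType C)
    (p1 : starHom A1 (La H1)) (p2 : starHom A2 (La H2))
    (j1 : starHom B1 A1) (j2 : starHom B2 A2) :
  hom_comp (lift_odot p1 p2) (fp_map j1 j2) =
    lift_odot (hom_comp p1 j1) (hom_comp p2 j2).
Proof.
apply: fp_hom_ext => b; rewrite hom_compE.
- by rewrite fp_mapl !lift_odot_inl.
- by rewrite fp_mapr !lift_odot_inr.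
Qed.

(** On generators this is universality of the two lifts, whose adjoint premise is the hypothesis at
    [star a]. *)
Lemma lift_odot_univ_space (A1 A2 : starAlgType C) (H1 H2 G1 G2 : preHilbType C)
    (W1 : arrow H1 G1) (W2 : arrow H2 G2)
    (p1 : starHom A1 (La H1)) (p2 : starHom A2 (La H2))
    (s1 : starHom A1 (La G1)) (s2 : starHom A2 (La G2)) :
  (forall a x, W1 (p1 a x) = s1 a (W1 x)) ->
  (forall a x, W2 (p2 a x) = s2 a (W2 x)) ->
  forall a x,
    boxm M W1 W2 (lift_odot p1 p2 a x) = lift_odot s1 s2 a (boxm M W1 W2 x).
Proof.
move=> ps1 ps2; apply: fp_intertwine => a x.
- rewrite !lift_odot_inl; apply: (left_lift_univ (lam_left L)) => // y.
  by have := ps1 (star a) y; rewrite !hom_star.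
- rewrite !lift_odot_inr; apply: (right_lift_univ (rho_right L)) => // y.
  by have := ps2 (star a) y; rewrite !hom_star.
Qed.

Lemma lift_odot_restr_l (A1 A2 : starAlgType C) (H1 H2 : preHilbType C)
    (p1 : starHom A1 (La H1)) (p2 : starHom A2 (La H2)) a x :
  lift_odot p1 p2 (fp_inl a) (emb_l M H1 H2 x) = emb_l M H1 H2 (p1 a x).
Proof. by rewrite lift_odot_inl (left_lift_restr (lam_left L)). Qed.

Lemma lift_odot_restr_r (A1 A2 : starAlgType C) (H1 H2 : preHilbType C)
    (p1 : starHom A1 (La H1)) (p2 : starHom A2 (La H2)) a x :
  lift_odot p1 p2 (fp_inr a) (emb_r M H1 H2 x) = emb_r M H1 H2 (p2 a x).
Proof. by rewrite lift_odot_inr (right_lift_restr (rho_right L)). Qed.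

Definition product_of_lift : universal_product M :=
  UniversalProduct lift_odot_assoc lift_odot_univ_alg lift_odot_univ_space
    lift_odot_restr_l lift_odot_restr_r.

End ProductOfLift.

(** * The two assignments are mutually inverse *)

Section Correspondence.
Variables (C : numClosedFieldType) (M : monoidal_product C).

(** [cancel] asks for equality of records; the axioms are propositions, so equality of the data
    suffices. *)
Lemma universal_lift_ext (L L' : universal_lift M) :
  (forall H1 H2, lam L H1 H2 = lam L' H1 H2) ->
  (forall H1 H2, rho L H1 H2 = rho L' H1 H2) -> L = L'.
Proof.
case: L L' => [l r l1 r1 m1] [l' r' l2 r2 m2] /= ll rr.
have El : l = l' by do 2!apply: functional_extensionality_dep => ?.
have Er : r = r' by do 2!apply: functional_extensionality_dep => ?.
by subst l' r'; congr UniversalLift; apply: Prop_irrelevance.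
Qed.

Lemma universal_product_ext (P Q : universal_product M) :
  (forall (A1 A2 : starAlgType C) (H1 H2 : preHilbType C)
      (p1 : starHom A1 (La H1)) (p2 : starHom A2 (La H2)),
    odot P p1 p2 = odot Q p1 p2) -> P = Q.
Proof.
case: P Q => [o ? ? ? ? ?] [o' ? ? ? ? ?] /= oo.
have E : o = o' by do 6!apply: functional_extensionality_dep => ?.
by subst o'; congr UniversalProduct; apply: Prop_irrelevance.
Qed.

Lemma lift_of_productK : cancel (@lift_of_product C M) (@product_of_lift C M).
Proof.
move=> P; apply: universal_product_ext => A1 A2 H1 H2 p1 p2.
apply: fp_hom_ext => a.
- by rewrite (odot_inl P); apply: (lift_odot_inl (lift_of_product P)).
- by rewrite (odot_inr P); apply: (lift_odot_inr (lift_of_product P)).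
Qed.

Lemma product_of_liftK : cancel (@product_of_lift C M) (@lift_of_product C M).
Proof.
move=> L; apply: universal_lift_ext => H1 H2; apply: starHom_ext => T.
- exact: lift_odot_inl.
- exact: lift_odot_inr.
Qed.

End Correspondence.

Theorem theorem3p7 (R : realType) (M : monoidal_product R[i]) :
  exists (lift_of : universal_product M -> universal_lift M)
         (prod_of : universal_lift M -> universal_product M),
    (forall (P : universal_product M) (H1 H2 : preHilbType R[i]),
       lam (lift_of P) H1 H2 =
         hom_comp (odot P (hom_id (La H1)) (hom_id (La H2))) fp_inl /\
       rho (lift_of P) H1 H2 =
         hom_comp (odot P (hom_id (La H1)) (hom_id (La H2))) fp_inr) /\
    (forall (L : universal_lift M) (A1 A2 : starAlgType R[i])
            (H1 H2 : preHilbType R[i])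
            (p1 : starHom A1 (La H1)) (p2 : starHom A2 (La H2)),
       odot (prod_of L) p1 p2 =
         fp_copair (hom_comp (lam L H1 H2) p1) (hom_comp (rho L H1 H2) p2)) /\
    cancel lift_of prod_of /\
    cancel prod_of lift_of.
Proof.
exists (@lift_of_product _ M), (@product_of_lift _ M); split=> //; split=> //; split.
- exact: lift_of_productK.
- exact: product_of_liftK.
Qed.
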